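(* Let $C=\{(2,2),(2,3),(3,2),(3,3)\}$. For each of the following sets $T$, with $R=C\cup T$, we have $(123,R)\sim_d(132,R)$: (1) $T=\{(0,0)\}$; (2) $T=\{(0,1),(1,0)\}$; (3) $T=\{(0,0),(0,1),(1,0)\}$; (4) $T=\{(1,1)\}$; (5) $T=\{(0,0),(1,1)\}$; (6) $T=\{(0,1),(1,0),(1,1)\}$; (7) $T=\{(0,0),(0,1),(1,0),(1,1)\}$.
   Context: $S_n$ denotes the set of permutations of $[n]=\{1,\dots,n\}$, written $\pi=\pi_1\cdots\pi_n$. A mesh pattern of length $k$ is a pair $(\tau,R)$ with $\tau\in S_k$ and $R\subseteq\{0,1,\dots,k\}^2$ (the shaded boxes; box $(a,b)$ is the unit square $[a,a+1]\times[b,b+1]$ in the diagram of $\tau$). An occurrence of $(\tau,R)$ in $\pi\in S_n$ is a choice of indices $i_1<\dots<i_k$ such that $\pi_{i_1}\cdots\pi_{i_k}$ is order-isomorphic to $\tau$ and, with $i_0=0$, $i_{k+1}=n+1$, $v_1<\dots<v_k$ the values $\pi_{i_1},\dots,\pi_{i_k}$ sorted increasingly, $v_0=0$, $v_{k+1}=n+1$, for every $(a,b)\in R$ there is no index $m$ with $i_a<m<i_{a+1}$ and $v_b<\pi_m<v_{b+1}$. Mesh patterns $p,q$ are equidistributed, $p\sim_d q$, if for all $n,\ell\ge0$ the number of $\pi\in S_n$ with exactly $\ell$ occurrences of $p$ equals the number with exactly $\ell$ occurrences of $q$. *)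

(* Defs.v *)
From mathcomp Require Import all_boot all_fingroup.

Set Implicit Arguments.
Unset Strict Implicit.
Unset Printing Implicit Defensive.

(* 'S_n acts on 'I_n = {0, ..., n-1}: the index m : 'I_n stands for m.+1 in [n],
   and the value pi m stands for (pi m).+1. Box coordinates are not shifted. *)

Record mesh_pattern := Mesh {
  mesh_size : nat;
  mesh_perm : 'S_mesh_size;
  mesh_shading : {set 'I_mesh_size.+1 * 'I_mesh_size.+1}
}.

Section Occurrences.

Variables (n k : nat) (pi : 'S_n) (i : {ffun 'I_k -> 'I_n}).

(* i_0 = 0, i_1, ..., i_k, i_{k+1} = n+1, as numbers in {0, ..., n+1} *)
Definition index_bounds : seq nat :=
  0 :: rcons [seq (i j).+1 | j : 'I_k] n.+1.

(* v_0 = 0, v_1 < ... < v_k, v_{k+1} = n+1, as numbers in {0, ..., n+1} *)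
Definition value_bounds : seq nat :=
  0 :: rcons (sort leq [seq (pi (i j)).+1 | j : 'I_k]) n.+1.

Definition in_box (a b : nat) (m : 'I_n) : bool :=
  (nth 0 index_bounds a < m.+1 < nth 0 index_bounds a.+1) &&
  (nth 0 value_bounds b < (pi m).+1 < nth 0 value_bounds b.+1).

Definition increasing_indices : bool :=
  [forall j1 : 'I_k, forall j2 : 'I_k, (j1 < j2) ==> (i j1 < i j2)].

Definition order_isomorphic (tau : 'S_k) : bool :=
  [forall j1 : 'I_k, forall j2 : 'I_k,
    (pi (i j1) < pi (i j2)) == (tau j1 < tau j2)].

Definition is_occurrence (tau : 'S_k) (R : {set 'I_k.+1 * 'I_k.+1}) : bool :=
  [&& increasing_indices, order_isomorphic tau &
      [forall ab in R, ~~ [exists m : 'I_n, in_box ab.1 ab.2 m]]].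

End Occurrences.

Definition occurrences (p : mesh_pattern) n (pi : 'S_n) : nat :=
  #|[set i : {ffun 'I_(mesh_size p) -> 'I_n}
      | is_occurrence pi i (mesh_perm p) (mesh_shading p)]|.

Definition equidistributed (p q : mesh_pattern) : Prop :=
  forall n l : nat,
    #|[set pi : 'S_n | occurrences p pi == l]| =
    #|[set pi : 'S_n | occurrences q pi == l]|.

Notation "p ~d q" := (equidistributed p q) (at level 70, no associativity).

Definition perm123 : 'S_3 := 1%g.
Definition perm132 : 'S_3 := tperm (inord 1) (inord 2).

Definition one_line n (pi : 'S_n) : seq nat := [seq (pi m).+1 | m : 'I_n].

Lemma one_line_perm123 : one_line perm123 = [:: 1; 2; 3].
Proof.
by rewrite /one_line /image_mem !enum_ordSl enum_ord0 /= !perm1.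
Qed.

Lemma one_line_perm132 : one_line perm132 = [:: 1; 3; 2].
Proof.
rewrite /one_line /image_mem !enum_ordSl enum_ord0 /= !permE /=.
by rewrite -!(inj_eq val_inj) /= !inordK //= inordK.
Qed.

(* Meaningful for a, b <= 3 only: inord sends out-of-range numbers to 0. *)
Definition box (a b : nat) : 'I_4 * 'I_4 := (inord a, inord b).

Definition cornerC : {set 'I_4 * 'I_4} :=
  [set box 2 2; box 2 3; box 3 2; box 3 3].

(* Main.v *)
Require Import Defs.
From mathcomp Require Import all_boot all_fingroup.
From mathcomp Require Import zify.

(* The shading of C says that (p, x, z) is an occurrence only if every other point
   to the right of x lies below both x and z; both patterns impose this same condition
   [spot x z], and they differ only in whether the values at x and z ascend or
   descend. The boxes of T constrain p inside the region strictly left of x and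
   below both x and z.  Exchanging the values at x and z turns an ascending spot into
   a descending one and conversely. It alters neither the direction of the spots at
   the other indices nor, for any index, the points of that region. Doing this at
   every index is a bijection of S_n that carries the occurrences of 132 to those
   of 123. *)

Set Implicit Arguments.
Unset Strict Implicit.
Unset Printing Implicit Defensive.

(** * Spots: two positions whose values exceed all others to the right of the first *)

Section Spots.

Variable n : nat.
Implicit Types (pi : 'S_n) (x z u w m p : 'I_n).

Definition spot pi x z : bool :=
  (x < z) && [forall m : 'I_n, (x < m) ==> (m != z) ==> (pi m < pi x) && (pi m < pi z)].

Definition has_spot pi x : bool := [exists z, spot pi x z].

Definition ascending pi x : bool := [exists z, spot pi x z && (pi x < pi z)].

(** The partner [z] is unique when it exists, so quantifying over it makes this region depend on [x]
    alone; it is empty when [x] has no spot. *)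
Definition below pi x : {set 'I_n} :=
  [set m : 'I_n | (m < x) &&
           [exists z, [&& spot pi x z, pi m < pi x & pi m < pi z]]].

Lemma spotP pi x z :
  reflect (x < z /\ forall m : 'I_n, x < m -> m != z -> pi m < pi x /\ pi m < pi z)
          (spot pi x z).
Proof.
apply: (iffP andP) => -[xz H]; split=> //.
  by move=> m xm mz; move/forallP/(_ m): H; rewrite xm mz => /andP.
by apply/forallP=> m; apply/implyP=> xm; apply/implyP=> mz; apply/andP/H.
Qed.

(** Two distinct partners would each have to lie below the other. *)
Lemma spot_inj pi x z z' : spot pi x z -> spot pi x z' -> z = z'.
Proof.
move=> /spotP[xz H] /spotP[xz' H']; apply/eqP/contraT => zz'.
have [_ ?] := H' z xz zz'.
have [|_ ?] := H z' xz'; first by rewrite eq_sym.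
lia.
Qed.

Lemma spot_neq pi x z : spot pi x z -> pi x != pi z :> nat.
Proof.
move=> /spotP[xz _]; rewrite (inj_eq val_inj) (inj_eq perm_inj).
by apply: contraL xz => /eqP ->; rewrite ltnn.
Qed.

Lemma ascendingE pi x z : spot pi x z -> ascending pi x = (pi x < pi z).
Proof.
move=> xz; apply/existsP/idP => [[z' /andP[xz']]|lt]; last first.
  by exists z; rewrite xz.
by rewrite (spot_inj xz xz').
Qed.

Lemma belowE pi x z m :
  spot pi x z -> (m \in below pi x) = [&& m < x, pi m < pi x & pi m < pi z].
Proof.
move=> xz; rewrite inE; congr (_ && _); apply/existsP/idP => [[z' /andP[xz']]|lt].
  by rewrite (spot_inj xz xz').
by exists z; rewrite xz.
Qed.

Lemma below_has_spot pi x m : m \in below pi x -> has_spot pi x.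
Proof.
by rewrite inE => /andP[_ /existsP[z /and3P[xz _ _]]]; apply/existsP; exists z.
Qed.

(** * Exchanging the two values of a spot *)

Section Exchange.

Variables (pi : 'S_n) (x z : 'I_n).
Hypothesis xz : spot pi x z.

Let pi' : 'S_n := (tperm x z * pi)%g.

Lemma exchange_fix m : m != x -> m != z -> pi' m = pi m.
Proof. by move=> mx mz; rewrite permM tpermD // eq_sym. Qed.

Lemma exchangeL : pi' x = pi z. Proof. by rewrite permM tpermL. Qed.
Lemma exchangeR : pi' z = pi x. Proof. by rewrite permM tpermR. Qed.

Lemma exchange_spot : spot pi' x z.
Proof.
case/spotP: (xz) => lt H; apply/spotP; split=> // m xm mz.
have mx : m != x by apply: contraL xm => /eqP ->; rewrite ltnn.
rewrite exchangeL exchangeR exchange_fix //.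
by case: (H m xm mz).
Qed.

(** To the right of [x], position [z] holds the largest value both before and after the exchange,
    and no other value changes there. *)
Lemma exchange_ltn (k l : 'I_n) : x < k -> x < l -> (pi' k < pi' l) = (pi k < pi l).
Proof.
move=> xk xl; case/spotP: (xz) => lt H.
have nx (m : 'I_n) : x < m -> m != x by move=> xm; apply: contraL xm => /eqP ->; rewrite ltnn.
have [->|kz] := eqVneq k z; have [->|lz] := eqVneq l z; rewrite ?ltnn //.
- rewrite exchangeR exchange_fix ?nx //; case: (H l xl lz) => ? ?; lia.
- rewrite exchangeR exchange_fix ?nx //; case: (H k xk kz) => ? ?; lia.
- by rewrite !exchange_fix ?nx.
Qed.

(** If [u] is left of [x], the exchange only permutes positions right of [u], and the partner
    follows its value. If [u] is right of [x], the order of the values right of [x] is kept, so the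
    partner stays. *)
Lemma exchange_spot_neq u w : u != x -> spot pi u w ->
  exists w', [/\ spot pi' u w', (pi' u < pi' w') = (pi u < pi w) &
    forall m : 'I_n, m < u -> pi m < pi u -> pi m < pi w ->
      [/\ pi' m = pi m, pi' m < pi' u & pi' m < pi' w']].
Proof.
move=> ux /spotP[uw Hu]; case/spotP: (xz) => lt H.
have [lux|lxu|/val_inj/eqP] := ltngtP u x; last by rewrite (negPf ux).
  have uz : u != z by apply/eqP=> E; move: lux; rewrite E; lia.
  have tgt (k : 'I_n) : u < k -> u < tperm x z k.
    by case: tpermP => // _ _; apply: ltn_trans lt.
  (* This is the position to which the value [pi w] has moved. *)
  exists (tperm x z w); split; last 1 first.
  - move=> m mu ? ?.
    have mx : m != x by apply/eqP=> E; move: mu; rewrite E; lia.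
    have mz : m != z by apply/eqP=> E; move: mu; rewrite E; lia.
    by rewrite (exchange_fix mx mz) (exchange_fix ux uz) /pi' permM tpermK.
  - apply/spotP; split=> [|m um mw]; first exact: tgt.
    rewrite (exchange_fix ux uz) /pi' !permM tpermK; apply: Hu; first exact: tgt.
    by apply: contraNneq mw => <-; rewrite tpermK.
  - by rewrite (exchange_fix ux uz) /pi' permM tpermK.
have lxw : x < w by exact: ltn_trans uw.
exists w; split; last 1 first.
- move=> m mu mpu mpw.
  have wu : w != u by apply: contraL uw => /eqP ->; rewrite ltnn.
  (* At least one of [u], [w] differs from [z]; its value is below those of [x] and [z], which keeps
     [m] away from both. *)
  have [k [kz xk kuw]] : exists k : 'I_n, [/\ k != z, x < k & pi m < pi k].
    have [E|uz] := eqVneq u z; [exists w | exists u]; split=> //.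
    by rewrite -E.
  have [kx kzz] := H k xk kz.
  have mx : m != x by apply/eqP=> E; move: kuw; rewrite E; lia.
  have mz : m != z by apply/eqP=> E; move: kuw; rewrite E; lia.
  have lif (l : 'I_n) : x < l -> pi m < pi l -> pi m < pi' l.
    move=> xl ml; have [->|lz] := eqVneq l z; first by rewrite exchangeR; lia.
    by rewrite exchange_fix //; apply: contraL xl => /eqP ->; rewrite ltnn.
  by rewrite exchange_fix // !lif.
- apply/spotP; split=> // m um mw; have xm : x < m by exact: ltn_trans um.
  by rewrite !exchange_ltn //; apply: Hu.
- exact: exchange_ltn.
Qed.

End Exchange.

Lemma exchangeK pi x z : (tperm x z * (tperm x z * pi))%g = pi.
Proof. by rewrite mulgA tperm2 mul1g. Qed.

Lemma exchange_has_spot pi x z u :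
  spot pi x z -> has_spot (tperm x z * pi)%g u = has_spot pi u.
Proof.
(* One direction suffices: the exchanged permutation again has the spot [x], [z], and a second
   exchange restores [pi]. *)
have imp s : spot s x z -> has_spot s u -> has_spot (tperm x z * s)%g u.
  move=> xz; have [->|ux] := eqVneq u x.
    by move=> _; apply/existsP; exists z; apply: exchange_spot.
  move=> /existsP[w /(exchange_spot_neq xz ux)[w' [uw' _ _]]].
  by apply/existsP; exists w'.
move=> xz; apply/idP/idP; last exact: imp.
by move/(imp _ (exchange_spot xz)); rewrite exchangeK.
Qed.

Lemma exchange_ascending pi x z u :
  spot pi x z ->
  ascending (tperm x z * pi)%g u = (u == x) (+) ascending pi u.
Proof.
move=> xz; have [->|ux] /= := eqVneq u x.
  rewrite (ascendingE xz) (ascendingE (exchange_spot xz)) exchangeL exchangeR.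
  by rewrite ltn_neqAle leqNgt eq_sym (spot_neq xz).
apply/idP/idP.
  move=> /existsP[w /andP[uw lt]].
  have [w' [uw' E _]] := exchange_spot_neq (exchange_spot xz) ux uw.
  by rewrite exchangeK in uw' E; apply/existsP; exists w'; rewrite uw' E.
move=> /existsP[w /andP[uw lt]].
have [w' [uw' E _]] := exchange_spot_neq xz ux uw.
by apply/existsP; exists w'; rewrite uw' E.
Qed.

(** Neither [x] nor [z] lies in such a region, so its points keep their values, and the bounds of
    the region stay above them. *)
Lemma exchange_below_sub pi x z u m : spot pi x z -> m \in below pi u ->
  (m \in below (tperm x z * pi)%g u) /\ (tperm x z * pi)%g m = pi m.
Proof.
move=> xz; have [->|ux] := eqVneq u x.
  case/spotP: (xz) => lt _.
  rewrite (belowE _ xz) (belowE _ (exchange_spot xz)) => /and3P[mx mpx mpz].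
  rewrite exchangeL exchangeR exchange_fix ?mx ?mpx ?mpz //.
    by apply/eqP=> E; move: mx; rewrite E ltnn.
  by apply/eqP=> E; move: mx; rewrite E; lia.
rewrite !inE => /andP[mu /existsP[w /and3P[uw mpu mpw]]].
have [w' [uw' _ /(_ m mu mpu mpw)[E ? ?]]] := exchange_spot_neq xz ux uw.
by split=> //; rewrite mu; apply/existsP; exists w'; apply/and3P.
Qed.

Lemma exchange_below pi x z u :
  spot pi x z -> below (tperm x z * pi)%g u = below pi u.
Proof.
move=> xz; apply/setP=> m; apply/idP/idP.
  by move/(exchange_below_sub (exchange_spot xz)) => []; rewrite exchangeK.
by move/(exchange_below_sub xz) => [].
Qed.

(** * Toggling the direction of spots, one index at a time *)

Definition toggle x pi : 'S_n :=
  if [pick z | spot pi x z] is Some z then (tperm x z * pi)%g else pi.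

(** After an exchange the spot at [x] still has partner [z], so the second toggle picks the same
    transposition. *)
Lemma toggleK x : involutive (toggle x).
Proof.
move=> pi; rewrite {2}/toggle; case: pickP => [z xz|no]; rewrite /toggle.
  case: pickP => [w xw|/(_ z)]; last by rewrite exchange_spot.
  by rewrite (spot_inj xw (exchange_spot xz)) exchangeK.
by case: pickP => // z; rewrite no.
Qed.

(** Partners are picked anew at each stage, since an exchange at one index may move the partner of
    another. *)
Definition toggle_all (s : seq 'I_n) pi : 'S_n := foldr toggle pi s.

Lemma toggle_all_inj s : injective (toggle_all s).
Proof. by elim: s => //= x s IHs pi pi' /(inv_inj (toggleK x)) /IHs. Qed.

Lemma toggle_has_spot x pi u : has_spot (toggle x pi) u = has_spot pi u.
Proof. by rewrite /toggle; case: pickP => // z /exchange_has_spot. Qed.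

Lemma toggle_ascending x pi u : has_spot pi u ->
  ascending (toggle x pi) u = (u == x) (+) ascending pi u.
Proof.
rewrite /toggle; case: pickP => [z /exchange_ascending //|no].
case/existsP=> w uw; case: eqVneq => // E.
by have := no w; rewrite -E uw.
Qed.

(* [true] codes the row or column index 1 of a box, [false] the index 0. *)
Definition quadrant (a b : bool) pi p m : bool :=
  (if a then p < m else m < p) && (if b then pi p < pi m else pi m < pi p).

(** The first points [p] allowed by the boxes of [Q]. Only points of [below pi x] and their values
    enter, which is what makes the set invariant under toggles. *)
Definition admissible (Q : {set 'I_4 * 'I_4}) pi x : {set 'I_n} :=
  [set p in below pi x | [forall ab in Q,
    ~~ [exists m in below pi x, quadrant (0 < ab.1) (0 < ab.2) pi p m]]].

Lemma toggle_admissible Q x pi u :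
  admissible Q (toggle x pi) u = admissible Q pi u.
Proof.
rewrite /toggle; case: pickP => // z xz; apply/setP=> p.
have fixm m : m \in below pi u -> (tperm x z * pi)%g m = pi m.
  by case/(exchange_below_sub xz).
rewrite [LHS]in_set [RHS]in_set exchange_below //; apply: andb_id2l => pu.
apply: eq_forallb => ab; congr (_ ==> ~~ _); apply: eq_existsb => m.
by apply: andb_id2l => mu; rewrite /quadrant !fixm.
Qed.

(** Without repetitions in [s], each listed index is toggled exactly once. *)
Lemma toggle_allP Q s pi u : uniq s ->
  [/\ has_spot (toggle_all s pi) u = has_spot pi u,
      has_spot pi u ->
        ascending (toggle_all s pi) u = (u \in s) (+) ascending pi u &
      admissible Q (toggle_all s pi) u = admissible Q pi u].
Proof.
elim: s => [|x s IHs] //= /andP[xs /IHs[Hs Ha HA]]; split.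
- by rewrite toggle_has_spot.
- move=> us; rewrite toggle_ascending ?Hs // Ha // inE addbA; congr (_ (+) _).
  by case: eqVneq xs => // -> /negPf ->.
- by rewrite toggle_admissible.
Qed.

End Spots.

(** * Boxes of a mesh pattern of length three *)

Notation j0 := (@ord0 2).
(** The nested [lift] terms are the form produced by [big_ord_recl] and [enum_ordSl]. *)
Notation j1 := (lift j0 ord0).
Notation j2 := (lift j0 (lift ord0 ord0)).

Lemma forall_ord3 (P : pred 'I_3) : [forall j, P j] = [&& P j0, P j1 & P j2].
Proof.
transitivity (\big[andb/true]_(j < 3) P j); first by rewrite big_andE.
by rewrite !big_ord_recl big_ord0 andbT.
Qed.

Lemma image_ord3 (T : Type) (f : 'I_3 -> T) :
  [seq f j | j : 'I_3] = [:: f j0; f j1; f j2].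
Proof. by rewrite /image_mem !enum_ordSl enum_ord0. Qed.

Section Occurrences3.

Variables (n : nat) (pi : 'S_n) (i : {ffun 'I_3 -> 'I_n}).
Notation p := (i j0).
Notation x := (i j1).
Notation z := (i j2).

Lemma increasing_indices3 : increasing_indices i = (p < x) && (x < z).
Proof.
rewrite /increasing_indices forall_ord3 !forall_ord3 /=.
lia.
Qed.

Lemma order_isomorphic_perm123 :
  order_isomorphic pi i perm123 = (pi p < pi x) && (pi x < pi z).
Proof.
rewrite /order_isomorphic forall_ord3 !forall_ord3 !perm1 /= /bump !ltnn /=.
case: ltngtP; case: ltngtP; case: ltngtP => //=; lia.
Qed.

Lemma order_isomorphic_perm132 :
  order_isomorphic pi i perm132 = (pi p < pi z) && (pi z < pi x).
Proof.
have E1 : inord 1 = j1 by apply: val_inj; rewrite /= inordK.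
have E2 : inord 2 = j2 by apply: val_inj; rewrite /= inordK.
rewrite /order_isomorphic forall_ord3 !forall_ord3 /perm132 E1 E2.
rewrite tpermL tpermR tpermD // /= /bump !ltnn /=.
case: ltngtP; case: ltngtP; case: ltngtP => //=; lia.
Qed.

Hypotheses (px : p < x) (xz : x < z).
Hypotheses (ppx : pi p < pi x) (ppz : pi p < pi z).

(** As [pi p] is the smallest of the three values, [lo] and [hi] are the other two in sorted order,
    so one computation serves both patterns. *)
Let lo := minn (pi x) (pi z).
Let hi := maxn (pi x) (pi z).

Lemma index_bounds3 : index_bounds i = [:: 0; p.+1; x.+1; z.+1; n.+1].
Proof. by rewrite /index_bounds image_ord3. Qed.

Lemma value_bounds3 : value_bounds pi i = [:: 0; (pi p).+1; lo.+1; hi.+1; n.+1].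
Proof.
have E : sort leq [seq (pi (i j)).+1 | j : 'I_3] = [:: (pi p).+1; lo.+1; hi.+1].
  rewrite image_ord3; apply: (sorted_eq leq_trans anti_leq).
  - exact: sort_sorted leq_total _.
  - by rewrite /= /lo /hi; lia.
  rewrite perm_sort perm_cons /lo /hi.
  case: (leqP (pi x) (pi z)) => // _.
  exact/permPl/(perm_catC [:: _] [:: _]).
by rewrite /value_bounds E.
Qed.

Lemma in_boxE a b m : in_box pi i a b m =
  (nth 0 [:: 0; p.+1; x.+1; z.+1; n.+1] a < m.+1
     < nth 0 [:: 0; p.+1; x.+1; z.+1; n.+1] a.+1) &&
  (nth 0 [:: 0; (pi p).+1; lo.+1; hi.+1; n.+1] b < (pi m).+1
     < nth 0 [:: 0; (pi p).+1; lo.+1; hi.+1; n.+1] b.+1).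
Proof. by rewrite /in_box index_bounds3 value_bounds3. Qed.

Lemma in_box_quadrant a b m : a < 2 -> b < 2 ->
  in_box pi i a b m = [&& m < x, pi m < lo & quadrant (0 < a) (0 < b) pi p m].
Proof.
by rewrite in_boxE /quadrant; case: a b => [|[|//]] [|[|//]] _ _ /=; lia.
Qed.

Variable T : {set 'I_4 * 'I_4}.
Hypothesis T_lt2 : forall ab, ab \in T -> (ab.1 < 2) && (ab.2 < 2).

Lemma exists_in_box ab : spot pi x z -> ab \in T ->
  [exists m, in_box pi i ab.1 ab.2 m] =
  [exists m in below pi x, quadrant (0 < ab.1) (0 < ab.2) pi p m].
Proof.
move=> sxz /T_lt2/andP[a2 b2]; apply: eq_existsb => m.
by rewrite in_box_quadrant // (belowE _ sxz) /lo leq_min -!andbA.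
Qed.

(** The boxes of [cornerC] cover what is right of [x] and above [lo], apart from the grid lines
    through the chosen points; their emptiness is the spot condition. Those of [T] give
    admissibility. *)
Lemma shading3 :
  [forall ab in cornerC :|: T, ~~ [exists m, in_box pi i ab.1 ab.2 m]] =
  spot pi x z && (p \in admissible T pi x).
Proof.
apply/forall_inP/andP => [H|[sxz]].
  have sxz : spot pi x z.
    apply/spotP; split=> // m xm mz.
    have nbox a b : a < 4 -> b < 4 -> box a b \in cornerC -> ~~ in_box pi i a b m.
      move=> a4 b4 Cab; have /existsPn/(_ m) : ~~ [exists m, in_box pi i (box a b).1 (box a b).2 m].
        by apply: H; rewrite inE Cab.
      by rewrite /= !inordK.
    have := nbox 2 2 isT isT; have := nbox 2 3 isT isT.
    have := nbox 3 2 isT isT; have := nbox 3 3 isT isT.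
    rewrite !inE !eqxx !orbT !in_boxE /= => /(_ isT) ? /(_ isT) ? /(_ isT) ? /(_ isT) ?.
    have mx : m != x by apply: contraL xm => /eqP ->; rewrite ltnn.
    (* By injectivity [m] lies on no grid line, so avoiding the four boxes forces it below [lo]. *)
    have pmx : pi m != pi x :> nat by rewrite (inj_eq val_inj) (inj_eq perm_inj).
    have pmz : pi m != pi z :> nat by rewrite (inj_eq val_inj) (inj_eq perm_inj).
    have mz' : m != z :> nat by [].
    have := ltn_ord m; have := ltn_ord (pi m).
    rewrite /lo /hi in mx pmx pmz *; lia.
  split=> //; rewrite inE (belowE _ sxz) px ppx ppz.
  apply/forall_inP => ab Tab; rewrite -exists_in_box //.
  by apply: H; rewrite inE Tab orbT.
rewrite inE => /andP[_ /forall_inP HT] ab; rewrite inE.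
case/orP=> [Cab|Tab]; last by rewrite exists_in_box // HT.
apply/existsPn => m; apply/negP => B.
have [xm mz lom] : [/\ x < m, m != z :> nat & lo < pi m].
  move: Cab B; rewrite !inE -!orbA => /or4P[] /eqP->; rewrite /= !inordK // in_boxE /= => B;
  rewrite /lo /hi in B *; split; lia.
by case/spotP: sxz => _ /(_ m xm mz); rewrite /lo in lom *; lia.
Qed.

End Occurrences3.

(** * Occurrences counted by their first two points *)

Section Occurrences123and132.

Variable T : {set 'I_4 * 'I_4}.
Hypothesis T_lt2 : forall ab, ab \in T -> (ab.1 < 2) && (ab.2 < 2).

Variables (n : nat) (pi : 'S_n).

(** Conversely to [shading3], admissibility of [i j0] puts it in [below], which returns the order
    conditions on the first point. *)
Lemma is_occurrence123 (i : {ffun 'I_3 -> 'I_n}) :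
  is_occurrence pi i perm123 (cornerC :|: T) =
  [&& spot pi (i j1) (i j2), pi (i j1) < pi (i j2) & i j0 \in admissible T pi (i j1)].
Proof.
rewrite /is_occurrence increasing_indices3 order_isomorphic_perm123.
apply/and3P/and3P => [[/andP[px xz] /andP[ppx pxz]]|[sxz pxz A]].
  have ppz := ltn_trans ppx pxz.
  by rewrite shading3 // => /andP[-> ->]; rewrite pxz.
move: (A); rewrite inE => /andP[]; rewrite (belowE _ sxz) => /and3P[px ppx ppz] _.
case/spotP: (sxz) => xz _.
by rewrite shading3 // px xz ppx pxz sxz A.
Qed.

Lemma is_occurrence132 (i : {ffun 'I_3 -> 'I_n}) :
  is_occurrence pi i perm132 (cornerC :|: T) =
  [&& spot pi (i j1) (i j2), pi (i j2) < pi (i j1) & i j0 \in admissible T pi (i j1)].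
Proof.
rewrite /is_occurrence increasing_indices3 order_isomorphic_perm132.
apply/and3P/and3P => [[/andP[px xz] /andP[ppz pzx]]|[sxz pzx A]].
  have ppx := ltn_trans ppz pzx.
  by rewrite shading3 // => /andP[-> ->]; rewrite pzx.
move: (A); rewrite inE => /andP[]; rewrite (belowE _ sxz) => /and3P[px ppx ppz] _.
case/spotP: (sxz) => xz _.
by rewrite shading3 // px xz ppz pzx sxz A.
Qed.

(** The third index is the unique partner of the second, so forgetting it is injective. *)
Lemma card_spot_triples (d : bool) :
  #|[set i : {ffun 'I_3 -> 'I_n} | [&& spot pi (i j1) (i j2),
       (pi (i j1) < pi (i j2)) == d & i j0 \in admissible T pi (i j1)]]| =
  #|[set px | (ascending pi px.2 == d) && (px.1 \in admissible T pi px.2)]|.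
Proof.
rewrite -(card_in_imset (f := fun i : {ffun 'I_3 -> 'I_n} => (i j0, i j1))).
  apply: eq_card => -[p x]; apply/imsetP/idP => [[i]|].
    by rewrite !inE => /and3P[sxz d_xz A] [-> ->] /=; rewrite (ascendingE sxz) d_xz.
  rewrite inE /= => /andP[dx A].
  have /existsP[z sxz] : has_spot pi x.
    by move: A; rewrite inE => /andP[/below_has_spot].
  (* The default [p] of [nth] is never reached. *)
  exists [ffun j : 'I_3 => nth p [:: p; x; z] j]; last by rewrite !ffunE.
  by rewrite inE !ffunE /= sxz -(ascendingE sxz) dx.
move=> i i'; rewrite !inE => /and3P[s _ _] /and3P[s' _ _] [E0 E1].
rewrite -E1 in s'; have E2 := spot_inj s s'.
apply/ffunP=> j; apply/eqP; move: j; apply/forallP.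
by rewrite forall_ord3 E0 E1 E2 !eqxx.
Qed.

Lemma occurrences123 : occurrences (Mesh perm123 (cornerC :|: T)) pi =
  #|[set px | (ascending pi px.2 == true) && (px.1 \in admissible T pi px.2)]|.
Proof.
rewrite -card_spot_triples; apply: eq_card => i.
by rewrite [LHS]in_set [RHS]in_set is_occurrence123 eqb_id.
Qed.

Lemma occurrences132 : occurrences (Mesh perm132 (cornerC :|: T)) pi =
  #|[set px | (ascending pi px.2 == false) && (px.1 \in admissible T pi px.2)]|.
Proof.
rewrite -card_spot_triples; apply: eq_card => i.
rewrite [LHS]in_set [RHS]in_set is_occurrence132; apply: andb_id2l => s.
(* The two values of a spot differ, so not ascending means descending. *)
by rewrite eqbF_neg -leqNgt [in RHS]leq_eqVlt eq_sym (negPf (spot_neq s)).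
Qed.

End Occurrences123and132.

(** Coordinates below 2 keep the boxes of [T] inside the region fixed by all toggles. *)
Lemma equidistributed_corner (T : {set 'I_4 * 'I_4}) :
  (forall ab, ab \in T -> (ab.1 < 2) && (ab.2 < 2)) ->
  Mesh perm123 (cornerC :|: T) ~d Mesh perm132 (cornerC :|: T).
Proof.
move=> T_lt2 n l.
pose phi := @toggle_all n (enum 'I_n).
have phi_bij : bijective phi by apply/injF_bij/toggle_all_inj.
have occ_phi pi : occurrences (Mesh perm123 (cornerC :|: T)) (phi pi) =
                  occurrences (Mesh perm132 (cornerC :|: T)) pi.
  rewrite occurrences123 // occurrences132 //; apply: eq_card => -[p x].
  rewrite [LHS]in_set [RHS]in_set /=.
  have [_ asc ->] := toggle_allP T pi x (enum_uniq 'I_n).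
  (* The direction flips only where there is a spot; an admissible [p] guarantees one at [x]. *)
  apply: andb_id2r => A; rewrite asc ?mem_enum.
    by case: ascending.
  by move: A; rewrite inE => /andP[/below_has_spot].
(* The set counted for 132 is the preimage under [phi] of the one counted for 123. *)
rewrite -(on_card_preimset (onW_bij _ phi_bij)).
by apply: eq_card => pi; rewrite !inE occ_phi.
Qed.

Theorem theorem4p5 (T : {set 'I_4 * 'I_4}) :
  T \in [:: [set box 0 0];
            [set box 0 1; box 1 0];
            [set box 0 0; box 0 1; box 1 0];
            [set box 1 1];
            [set box 0 0; box 1 1];
            [set box 0 1; box 1 0; box 1 1];
            [set box 0 0; box 0 1; box 1 0; box 1 1]] ->
  @Mesh 3 perm123 (cornerC :|: T) ~d @Mesh 3 perm132 (cornerC :|: T).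
Proof.
move=> HT; apply: equidistributed_corner => ab Tab.
(* The last of the seven sets contains all the others. *)
have : ab \in [set box 0 0; box 0 1; box 1 0; box 1 1].
  move: HT Tab; rewrite !inE.
  by repeat (case/orP); move=> /eqP->; rewrite !inE; repeat case/orP; move=> ->; rewrite ?orbT.
by rewrite !inE -!orbA => /or4P[] /eqP->; rewrite /= !inordK.
Qed.
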